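(* Let $\ell^{OI}$ be a line in a Desargues affine plane, with its skew field structure $(\ell^{OI},+,\cdot)$ given by addition and multiplication of points, and let $A,C,D\in\ell^{OI}$ be fixed. Let $\mathcal{R}^{B}_4=\{f_B(X)=c_r(A,X;C,D)\mid X\in\ell^{OI}\}$, where $c_r(A,X;C,D)=[(A-D)^{-1}(X-D)][(X-C)^{-1}(A-C)]$. Then for any three elements $f_B(X),f_B(Y),f_B(Z)$ of $\mathcal{R}^{B}_4$: (1) $f_B(X)\cdot[f_B(Y)+f_B(Z)]=f_B(X)\cdot f_B(Y)+f_B(X)\cdot f_B(Z)$; and (2) $[f_B(X)+f_B(Y)]\cdot f_B(Z)=f_B(X)\cdot f_B(Z)+f_B(Y)\cdot f_B(Z)$.
   Context: A Desargues affine plane is an affine plane (two distinct points lie on exactly one line; through a point $P$ not on a line $\ell$ passes exactly one line disjoint from $\ell$; there are three non-collinear points) satisfying Desargues' axiom: if $\ell^{AA'},\ell^{BB'},\ell^{CC'},\ell^{AC},\ell^{A'C'}$ are pairwise distinct lines such that $\ell^{AA'},\ell^{BB'},\ell^{CC'}$ are all parallel or all meet in one point $P$, and if $\ell^{AB}\parallel\ell^{A'B'}$, $\ell^{BC}\parallel\ell^{B'C'}$, $A\ne C$, $A'\ne C'$, $\ell^{AB}\ne\ell^{A'B'}$, $\ell^{BC}\ne\ell^{B'C'}$, then $\ell^{AC}\parallel\ell^{A'C'}$. Here $\ell^{PQ}$ is the line through $P,Q$, and $\ell^{R}_{PQ}$ is the line through $R$ parallel to $\ell^{PQ}$. Fix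 a line $\ell^{OI}$ through two distinct points $O,I$. For $A,B\in\ell^{OI}$ and an auxiliary point $B_1\notin\ell^{OI}$: addition: $P_1=\ell^{B_1}_{OI}\cap\ell^{A}_{OB_1}$ and $A+B=\ell^{P_1}_{BB_1}\cap\ell^{OI}$; multiplication: $P_1=\ell^{A}_{IB_1}\cap\ell^{OB_1}$ and $A\cdot B=\ell^{P_1}_{BB_1}\cap\ell^{OI}$. It is known that $(\ell^{OI},+,\cdot)$ is a skew field (division ring) with zero $O$ and unit $I$. Cross-ratio: for four points $A,B,C,D\in\ell^{OI}$, no three of them equal, $c_r(A,B;C,D)=[(A-D)^{-1}(B-D)][(B-C)^{-1}(A-C)]$, computed in this skew field. The paper writes the cross-ratio for all $X\in\ell^{OI}$ and gives no separate convention for a value of $X$ at which an inverse of $O$ would occur. The subscript $B$ in $f_B$ and superscript $B$ in $\mathcal{R}^{B}_4$ only indicate which of the four positions is variable. *)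

(* Defs.v *)
From Stdlib Require Import List ClassicalEpsilon.
Import ListNotations.

Set Implicit Arguments.
Unset Strict Implicit.

Record affine_plane := AffinePlane {
  point : Type;
  line : Type;
  on : point -> line -> Prop;
  unique_line : forall P Q : point, P <> Q ->
    exists! l : line, on P l /\ on Q l;
  unique_disjoint_line : forall (P : point) (l : line), ~ on P l ->
    exists! m : line, on P m /\ ~ (exists Q : point, on Q m /\ on Q l);
  noncollinear_points : exists P Q R : point,
    P <> Q /\ P <> R /\ Q <> R /\
    ~ (exists l : line, on P l /\ on Q l /\ on R l)
}.

Arguments on {a} P l.

Lemma point_inhabited (X : affine_plane) : inhabited (point X).
Proof. destruct (noncollinear_points X) as [P _]; exact (inhabits P). Qed.

Lemma line_inhabited (X : affine_plane) : inhabited (line X).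
Proof.
destruct (noncollinear_points X) as [P [Q [R [PQ _]]]].
destruct (unique_line PQ) as [l _]; exact (inhabits l).
Qed.

Section Constructions.
Context {X : affine_plane}.

Definition parallel (l m : line X) : Prop :=
  l = m \/ ~ (exists P : point X, on P l /\ on P m).

(* The next three choices are determined by the axioms for P <> Q, for any R
   and l, and for non-parallel l and m, respectively; they are only
   meaningful in these cases. *)
Definition lin (P Q : point X) : line X :=
  epsilon (line_inhabited X) (fun l => on P l /\ on Q l).

Definition par (R : point X) (l : line X) : line X :=
  epsilon (line_inhabited X) (fun m => on R m /\ parallel m l).

Definition meet (l m : line X) : point X :=
  epsilon (point_inhabited X) (fun P => on P l /\ on P m).

End Constructions.

(* The inequalities between points that are needed for every line named in the
   axiom to be the line through two distinct points are made explicit. *)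
Definition desargues_axiom (X : affine_plane) : Prop :=
  forall A B C A' B' C' : point X,
  A <> A' -> B <> B' -> C <> C' ->
  A <> B -> A' <> B' -> B <> C -> B' <> C' -> A <> C -> A' <> C' ->
  NoDup [lin A A'; lin B B'; lin C C'; lin A C; lin A' C'] ->
  (parallel (lin A A') (lin B B') /\ parallel (lin B B') (lin C C') /\
   parallel (lin A A') (lin C C')) \/
  (exists P : point X,
     on P (lin A A') /\ on P (lin B B') /\ on P (lin C C')) ->
  parallel (lin A B) (lin A' B') ->
  parallel (lin B C) (lin B' C') ->
  lin A B <> lin A' B' ->
  lin B C <> lin B' C' ->
  parallel (lin A C) (lin A' C').

Record desargues_plane := DesarguesPlane {
  plane :> affine_plane;
  desargues : desargues_axiom plane
}.

Section LineAlgebra.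
Context {X : desargues_plane}.
Variables O I : point X.

Definition add_aux (B1 A B : point X) : point X :=
  let P1 := meet (par B1 (lin O I)) (par A (lin O B1)) in
  meet (par P1 (lin B B1)) (lin O I).

Definition mul_aux (B1 A B : point X) : point X :=
  let P1 := meet (par A (lin I B1)) (lin O B1) in
  meet (par P1 (lin B B1)) (lin O I).

(* A + B and A . B are the results of the constructions for some auxiliary
   point off the line OI, not fixed in advance; in a Desargues plane these
   results do not depend on the auxiliary point. *)
Definition add (A B : point X) : point X :=
  epsilon (point_inhabited X)
    (fun S => exists B1 : point X, ~ on B1 (lin O I) /\ S = add_aux B1 A B).

Definition mul (A B : point X) : point X :=
  epsilon (point_inhabited X)
    (fun S => exists B1 : point X, ~ on B1 (lin O I) /\ S = mul_aux B1 A B).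

Definition opp (A : point X) : point X :=
  epsilon (point_inhabited X) (fun S => on S (lin O I) /\ add A S = O).

Definition sub (A B : point X) : point X := add A (opp B).

(* The inverse of O is an unspecified point of the line OI. *)
Definition inv (A : point X) : point X :=
  epsilon (point_inhabited X)
    (fun S => on S (lin O I) /\ (A <> O -> mul A S = I /\ mul S A = I)).

Definition cross_ratio (A B C D : point X) : point X :=
  mul (mul (inv (sub A D)) (sub B D)) (mul (inv (sub B C)) (sub A C)).

Definition R4B (A C D : point X) : point X -> Prop :=
  fun r => exists B : point X, on B (lin O I) /\ r = cross_ratio A B C D.

End LineAlgebra.

(* Main.v *)
(* Dilations are maps f with PQ // f(P)f(Q). A dilation is determined by its
   values at two points, and Desargues' axiom provides all translations and all
   homotheties. Reading off the two constructions, A + B is the image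
   of B under the translation O |-> A, and A . B the image of B under the
   homothety with centre O and I |-> A, whatever the auxiliary point.
   Left distributivity holds because a dilation fixing O is additive; right
   distributivity because the pointwise sum of the homotheties of A and B is a
   dilation fixing O and sending I to A + B, which uses commutativity of vector
   addition in the plane. Both laws hold for all points of OI, so of the
   cross-ratios only their membership in OI matters; for this the opposites and
   inverses must exist, since [opp] and [inv] are choices. *)
Require Import Defs.
From Stdlib Require Import List Classical ClassicalEpsilon ssreflect ssrfun.
Import ListNotations.

Set Implicit Arguments.
Unset Strict Implicit.

(** * Incidence and parallelism in an affine plane *)

Section Incidence.
Context {X : affine_plane}.
Implicit Types (P Q R S : point X) (l m n : line X).

Lemma line_eq P Q l m : P <> Q -> on P l -> on Q l -> on P m -> on Q m -> l = m.
Proof.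
move=> /unique_line [k [_ Hk]] Pl Ql Pm Qm.
by rewrite -(Hk l) // -(Hk m).
Qed.

Lemma lin_spec P Q : P <> Q -> on P (lin P Q) /\ on Q (lin P Q).
Proof.
move=> /unique_line [k [Hk _]].
by apply: (epsilon_spec _ (fun l => on P l /\ on Q l)); exists k.
Qed.

Lemma lin_l P Q : P <> Q -> on P (lin P Q).
Proof. by case/lin_spec. Qed.

Lemma lin_r P Q : P <> Q -> on Q (lin P Q).
Proof. by case/lin_spec. Qed.

Lemma lin_eq P Q l : P <> Q -> on P l -> on Q l -> lin P Q = l.
Proof. by move=> PQ Pl Ql; case: (lin_spec PQ) => ? ?; apply: (line_eq PQ). Qed.

Lemma lin_sym P Q : P <> Q -> lin P Q = lin Q P.
Proof. by move=> PQ; apply: lin_eq => //; [apply: lin_r|apply: lin_l]; auto. Qed.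

Lemma point_eq P Q l m : l <> m -> on P l -> on P m -> on Q l -> on Q m -> P = Q.
Proof. by move=> lm Pl Pm Ql Qm; apply: NNPP => PQ; apply: lm; apply: (line_eq PQ). Qed.

Lemma parallel_refl l : parallel l l.
Proof. by left. Qed.

Lemma parallel_sym l m : parallel l m -> parallel m l.
Proof.
case=> [->|H]; [by left|right=> -[P [? ?]]; apply: H; by exists P].
Qed.

Lemma playfair P l m : parallel l m -> on P l -> on P m -> l = m.
Proof. by case=> // H Pl Pm; case: H; exists P. Qed.

(** If distinct l and n met at P, both would be the unique line through P disjoint from m. *)
Lemma parallel_trans l m n : parallel l m -> parallel m n -> parallel l n.
Proof.
case=> [->//|lm] [<-|mn]; first by right.
apply: NNPP => H; apply: (H); right=> -[P [Pl Pn]].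
have Pm : ~ on P m by move=> Pm; apply: lm; exists P.
have [k [_ Hk]] := unique_disjoint_line Pm.
have kl : k = l by apply: Hk; split=> // -[Q [? ?]]; apply: lm; exists Q.
have kn : k = n by apply: Hk; split=> // -[Q [? ?]]; apply: mn; exists Q.
by apply: H; left; rewrite -kl.
Qed.

Lemma par_spec P l : on P (par P l) /\ parallel (par P l) l.
Proof.
apply: (epsilon_spec _ (fun m => on P m /\ parallel m l)).
case: (classic (on P l)) => [Pl|]; first by exists l; split=> //; left.
by move=> /unique_disjoint_line [m [[Pm H] _]]; exists m; split=> //; right.
Qed.

Lemma on_par P l : on P (par P l).
Proof. by case: (par_spec P l). Qed.

Lemma par_parallel P l : parallel (par P l) l.
Proof. by case: (par_spec P l). Qed.

Lemma par_eq P l m : on P m -> parallel m l -> par P l = m.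
Proof.
move=> Pm ml; apply: (playfair (P := P)) => //; last exact: on_par.
by apply: parallel_trans (par_parallel P l) _; apply: parallel_sym.
Qed.

Lemma par_id P l : on P l -> par P l = l.
Proof. by move=> Pl; apply: par_eq => //; left. Qed.

Lemma par_congr P l m : parallel l m -> par P l = par P m.
Proof.
move=> lm; apply: par_eq; first exact: on_par.
by apply: parallel_trans (par_parallel P m) _; apply: parallel_sym.
Qed.

Lemma par_par P Q l : par P (par Q l) = par P l.
Proof. exact/par_congr/par_parallel. Qed.

Lemma par_on P Q l : on P (par Q l) -> par P l = par Q l.
Proof. by move=> H; apply: par_eq => //; apply: par_parallel. Qed.

Lemma on_par_sym P Q l : on P (par Q l) -> on Q (par P l).
Proof. by move=> /par_on ->; apply: on_par. Qed.

Lemma par_neq P Q l m : ~ parallel l m -> par P l <> par Q m.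
Proof.
move=> lm E; apply: lm.
apply: parallel_trans (parallel_sym (par_parallel P l)) _.
by rewrite E; apply: par_parallel.
Qed.

Lemma not_parallel P l m : l <> m -> on P l -> on P m -> ~ parallel l m.
Proof. by move=> lm Pl Pm H; apply: lm; apply: (playfair H Pl Pm). Qed.

Lemma lines_meet l m : ~ parallel l m -> exists P, on P l /\ on P m.
Proof. by move=> H; apply: NNPP => H'; apply: H; right. Qed.

Lemma meet_eq P l m : l <> m -> on P l -> on P m -> meet l m = P.
Proof.
move=> lm Pl Pm.
have [] : on (meet l m) l /\ on (meet l m) m.
  by apply: (epsilon_spec _ (fun P => on P l /\ on P m)); exists P.
by move=> ? ?; apply: (point_eq lm).
Qed.

Lemma off_line l : exists P, ~ on P l.
Proof.
have [P [Q [R [_ [_ [_ H]]]]]] := noncollinear_points X.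
apply: NNPP => H'; apply: H; exists l.
by split; [|split]; apply: NNPP => ?; apply: H'; eexists; eassumption.
Qed.

Lemma line_through P Q : exists l, on P l /\ on Q l.
Proof.
case: (classic (P = Q)) => [<-|PQ]; last by exists (lin P Q); apply: lin_spec.
have [l] := line_inhabited X.
by exists (par P l); split; apply: on_par.
Qed.

Lemma not_parallel_lin P Q R l : on P l -> on Q l -> P <> Q -> ~ on R l ->
  ~ parallel (lin P R) (lin Q R).
Proof.
move=> Pl Ql PQ Rl.
have PR : P <> R by move=> E; subst.
have QR : Q <> R by move=> E; subst.
apply: (not_parallel (P := R)); try exact: lin_r.
move=> E; apply: Rl.
have QPR : on Q (lin P R) by rewrite E; apply: lin_l.
by rewrite (line_eq PQ Pl Ql (lin_l PR) QPR); apply: lin_r.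
Qed.

Lemma not_parallel_off P Q l : on P l -> ~ on Q l -> ~ parallel (lin P Q) l.
Proof.
move=> Pl Ql; have PQ : P <> Q by move=> E; subst.
apply: (not_parallel (P := P)) => //; last exact: lin_l.
by move=> E; apply: Ql; rewrite -E; apply: lin_r.
Qed.

End Incidence.

(** * Dilations: rigidity, injectivity, surjectivity *)

Section Dilations.
Context {X : affine_plane}.
Implicit Types (P Q R S : point X) (l m n : line X) (f g : point X -> point X).

(* Constant maps are allowed: they play the role of multiplication by zero. *)
Definition dilation f : Prop :=
  forall P Q l, on P l -> on Q l -> on (f Q) (par (f P) l).

Lemma dilation_id : dilation (fun P => P).
Proof. by move=> P Q l Pl Ql; rewrite par_id. Qed.

Lemma dilation_const P : dilation (fun _ => P).
Proof. by move=> *; apply: on_par. Qed.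

Lemma dilation_comp f g : dilation f -> dilation g -> dilation (fun P => f (g P)).
Proof.
move=> Hf Hg P Q l Pl Ql.
by rewrite -(par_par _ (g P)); apply: Hf; [apply: on_par|apply: Hg].
Qed.

(** The image of R is the intersection of two lines fixed by the data: the parallel to PR through
    [f P] and the parallel to QR through [f Q]. *)
Lemma dilation_ext_off f g P Q R l : dilation f -> dilation g -> P <> Q ->
  f P = g P -> f Q = g Q -> on P l -> on Q l -> ~ on R l -> f R = g R.
Proof.
move=> Hf Hg PQ fP fQ Pl Ql Rl.
have PR : P <> R by move=> E; subst.
have QR : Q <> R by move=> E; subst.
apply: (point_eq (par_neq (P := f P) (Q := f Q) (not_parallel_lin Pl Ql PQ Rl))).
- by apply: Hf; [apply: lin_l|apply: lin_r].
- by apply: Hf; [apply: lin_l|apply: lin_r].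
- by rewrite fP; apply: Hg; [apply: lin_l|apply: lin_r].
- by rewrite fQ; apply: Hg; [apply: lin_l|apply: lin_r].
Qed.

Lemma dilation_ext f g P Q : dilation f -> dilation g -> P <> Q ->
  f P = g P -> f Q = g Q -> forall R, f R = g R.
Proof.
move=> Hf Hg PQ fP fQ R.
have [Pl Ql] := lin_spec PQ.
case: (classic (on R (lin P Q))) => [Rl|]; last exact: (dilation_ext_off Hf Hg PQ).
case: (classic (R = P)) => [->//|RP].
(* For R on PQ, a point S off that line, where f and g already agree, replaces Q: then R is off
   PS. *)
have [S Sl] := off_line (lin P Q).
have PS : P <> S by move=> E; subst.
have fS : f S = g S by apply: (dilation_ext_off Hf Hg PQ fP fQ Pl Ql Sl).
apply: (dilation_ext_off Hf Hg PS fP fS (lin_l PS) (lin_r PS)) => RS.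
apply: Sl; rewrite (line_eq RP Rl Pl RS (lin_l PS)); exact: lin_r.
Qed.

(** By [dilation_ext], a dilation identifying two distinct points agrees with a constant map. *)
Lemma dilation_inj f P Q R S : dilation f -> f P <> f Q -> f R = f S -> R = S.
Proof.
move=> Hf fPQ fRS; apply: NNPP => RS; apply: fPQ.
have H := dilation_ext Hf (dilation_const (f R)) RS erefl (esym fRS).
by rewrite (H P) (H Q).
Qed.

Lemma dilation_surj_off f P Q R l : dilation f -> on (f P) l -> on (f Q) l ->
  f P <> f Q -> ~ on R l -> exists S, f S = R.
Proof.
move=> Hf Pl Ql fPQ Rl.
have PR : f P <> R by move=> E; subst.
have QR : f Q <> R by move=> E; subst.
have npar := not_parallel_lin Pl Ql fPQ Rl.
(* This S is forced: a preimage of R must lie on the parallels through P and Q to the lines joining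
   [f P] and [f Q] to R. *)
have [S [S1 S2]] : exists S, on S (par P (lin (f P) R)) /\ on S (par Q (lin (f Q) R)).
  apply: lines_meet => H; apply: npar.
  apply: parallel_trans (parallel_sym (par_parallel P _)) _.
  exact: parallel_trans H (par_parallel Q _).
exists S; apply: (point_eq (l := lin (f P) R) (m := lin (f Q) R)); try exact: lin_r.
- by move=> E; apply: npar; left.
- have := Hf _ _ _ (on_par P _) S1.
  by rewrite par_par par_id //; apply: lin_l.
- have := Hf _ _ _ (on_par Q _) S2.
  by rewrite par_par par_id //; apply: lin_l.
Qed.

Lemma dilation_surj f P Q R : dilation f -> f P <> f Q -> exists S, f S = R.
Proof.
move=> Hf fPQ.
have [Pl Ql] := lin_spec fPQ.
case: (classic (on R (lin (f P) (f Q)))) => [Rl|]; last exact: dilation_surj_off fPQ.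
case: (classic (R = f P)) => [->|RP]; first by exists P.
have [S Sl] := off_line (lin (f P) (f Q)).
have [S' ES] := dilation_surj_off Hf Pl Ql fPQ Sl; subst S.
have PS : f P <> f S' by move=> E; apply: Sl; rewrite -E.
apply: (dilation_surj_off Hf (lin_l PS) (lin_r PS) PS) => RS.
apply: Sl; rewrite (line_eq RP Rl Pl RS (lin_l PS)); exact: lin_r.
Qed.

(* A common point of two distinct traces P (f P) and R (f R) would be fixed. *)
Lemma trace_parallel f P l : dilation f -> (forall R, f R <> R) ->
  on P l -> on (f P) l -> forall R, on (f R) (par R l).
Proof.
move=> Hf nofix Pl fPl R.
have RR : R <> f R by move=> E; apply: (nofix R).
have [R1 R2] := lin_spec RR.
case: (classic (parallel (lin R (f R)) l)) => [H|H]; first by rewrite (par_eq R1 H).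
have [S [S1 S2]] := lines_meet H.
case: (nofix S); apply: (point_eq (l := lin R (f R)) (m := l)) => //.
- by move=> E; apply: H; left.
- by have := Hf _ _ _ R1 S1; rewrite par_id.
- by have := Hf _ _ _ Pl S2; rewrite par_id.
Qed.

End Dilations.

(** * Pencils of lines and the ray-preserving maps given by Desargues' axiom *)

Section Pencils.
Context {X : desargues_plane}.
Implicit Types (P Q R S T O A B C U : point X) (l m : line X).

(** A form of Desargues' axiom whose distinctness conditions are all non-incidences with a, b, c,
    which are easy to check on rays of a pencil. *)
Lemma desargues_lines (a b c : line X) A A' B B' C C' :
  (parallel a b /\ parallel b c /\ parallel a c) \/
    (exists P, on P a /\ on P b /\ on P c) ->
  on A a -> on A' a -> on B b -> on B' b -> on C c -> on C' c ->
  ~ on A b -> ~ on A c -> ~ on A' b -> ~ on A' c ->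
  ~ on B a -> ~ on B c -> ~ on B' a -> ~ on B' c ->
  ~ on C a -> ~ on C b -> ~ on C' a -> ~ on C' b ->
  A <> A' -> B <> B' -> C <> C' ->
  parallel (lin A B) (lin A' B') -> parallel (lin B C) (lin B' C') ->
  parallel (lin A C) (lin A' C').
Proof.
move=> Habc Aa A'a Bb B'b Cc C'c Ab Ac A'b A'c Ba Bc B'a B'c Ca Cb C'a C'b
  AA' BB' CC' HAB HBC.
case: (classic (lin A C = lin A' C')) => [->|ACn]; first exact: parallel_refl.
have ne : forall P Q l, on P l -> ~ on Q l -> P <> Q by move=> P Q l ? ? E; subst.
have [? ?] : A <> B /\ A' <> B' by split; apply: ne; eassumption.
have [? ?] : B <> C /\ B' <> C' by split; apply: ne; eassumption.
have [? ?] : A <> C /\ A' <> C' by split; apply: ne; eassumption.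
have Ea : lin A A' = a by apply: lin_eq.
have Eb : lin B B' = b by apply: lin_eq.
have Ec : lin C C' = c by apply: lin_eq.
apply: (desargues (A := A) (B := B) (C := C) (A' := A') (B' := B') (C' := C')) => //.
- rewrite Ea Eb Ec.
  have AC1 : on A (lin A C) by apply: lin_l.
  have AC2 : on C (lin A C) by apply: lin_r.
  have AC3 : on A' (lin A' C') by apply: lin_l.
  have AC4 : on C' (lin A' C') by apply: lin_r.
  clear Ea Eb Ec.
  clear Habc HAB HBC; have ACn' := not_eq_sym ACn.
  (* Two of the five lines are told apart by a point on just one of them, except AC and A'C', which
     differ by [ACn]. *)
  do 5 (apply: NoDup_cons => /=; [by intuition (subst; tauto)|]).
  exact: NoDup_nil.
- by rewrite Ea Eb Ec.
- move=> E; apply: Ba.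
  rewrite (line_eq (l := a) (m := lin A B) AA') //; try exact: lin_l; try exact: lin_r.
  by rewrite E; apply: lin_l.
- move=> E; apply: Cb.
  rewrite (line_eq (l := b) (m := lin B C) BB') //; try exact: lin_l; try exact: lin_r.
  by rewrite E; apply: lin_l.
Qed.

(* Parallel lines and lines through a centre are treated together; the centre
   itself is the only point that is not [regular]. *)
Inductive pencil := Parallels of line X | Center of point X.

Definition regular (p : pencil) P : Prop :=
  match p with Parallels _ => True | Center Q => P <> Q end.

Definition ray (p : pencil) P : line X :=
  match p with Parallels l => par P l | Center Q => lin Q P end.

Variable p : pencil.

Lemma on_ray P : regular p P -> on P (ray p P).
Proof. case: p => [l _|O H] /=; [exact: on_par|apply: lin_r; auto]. Qed.

Lemma ray_eq P Q : regular p P -> regular p Q -> on Q (ray p P) -> ray p Q = ray p P.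
Proof.
case: p => [l _ _|O /= PO QO] /=; first exact: par_on.
move=> H; apply: lin_eq => //; [by auto|apply: lin_l; auto].
Qed.

Lemma ray_off P Q : regular p P -> regular p Q -> ray p Q <> ray p P -> ~ on Q (ray p P).
Proof. by move=> gP gQ H HQ; apply: H; apply: ray_eq. Qed.

Lemma ray_neq P Q : ray p Q <> ray p P -> P <> Q.
Proof. by move=> H E; apply: H; rewrite E. Qed.

Lemma rays_incidence :
  (forall P Q, parallel (ray p P) (ray p Q)) \/
  (exists O, forall P, regular p P -> on O (ray p P)).
Proof.
case: p => [l|O]; [left=> P Q /=|right; exists O => P H /=].
- exact: parallel_trans (par_parallel P l) (parallel_sym (par_parallel Q l)).
- by apply: lin_l; auto.
Qed.

Lemma ray_other P : regular p P -> exists Q, regular p Q /\ ray p Q <> ray p P.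
Proof.
move=> gP; have [Q HQ] := off_line (ray p P).
have gQ : regular p Q.
  by move: gP HQ; case: p => //= O PO HQ E; apply: HQ; rewrite E; apply: lin_l; auto.
by exists Q; split=> // E; apply: HQ; rewrite -E; apply: on_ray.
Qed.

(* The alternative in the conclusion occurs in the plane of order two, whose
   parallel classes have only two lines. *)
Lemma third_ray P R T S : regular p P -> regular p R -> regular p T -> regular p S ->
  ray p R = ray p P -> ray p S = ray p T -> ray p T <> ray p P -> P <> R -> T <> S ->
  (exists U, regular p U /\ ray p U <> ray p P /\ ray p U <> ray p T) \/
  parallel (lin P S) (lin R T).
Proof.
move=> gP gR gT gS ERP EST NTP PR TS.
have TP : ~ on T (ray p P) by apply: ray_off.
have SP : ~ on S (ray p P) by apply: ray_off => //; rewrite EST.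
have PT : ~ on P (ray p T) by apply: ray_off => //; auto.
have RT : ~ on R (ray p T) by apply: ray_off => //; rewrite ERP; auto.
have PP := on_ray gP; have TT := on_ray gT.
have RP : on R (ray p P) by rewrite -ERP; apply: on_ray.
have ST : on S (ray p T) by rewrite -EST; apply: on_ray.
have nPT : P <> T by move=> E; subst.
have nPS : P <> S by move=> E; subst.
have nRT : R <> T by move=> E; subst.
case: (classic (parallel (lin P S) (lin R T))) => [|npar]; first by right.
left; case: p gP gT TP SP PT RT PP TT RP ST => [l|O] /= gP gT TP SP PT RT PP TT RP ST.
(* The intersection U of PS and RT works: on the ray of P it would equal both P and R, on the ray of
   T both S and T. *)
- have [U [U1 U2]] := lines_meet npar.
  exists U; split=> //; split=> E.
  + have UP : on U (par P l) by rewrite -E; apply: on_par.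
    have N1 : par P l <> lin P S by move=> E'; apply: SP; rewrite E'; apply: lin_r.
    have N2 : par P l <> lin R T by move=> E'; apply: TP; rewrite E'; apply: lin_r.
    apply: PR; rewrite -(point_eq N1 UP U1 PP (lin_l nPS)).
    exact: (point_eq N2 UP U2 RP (lin_l nRT)).
  + have UT : on U (par T l) by rewrite -E; apply: on_par.
    have N1 : par T l <> lin P S by move=> E'; apply: PT; rewrite E'; apply: lin_l.
    have N2 : par T l <> lin R T by move=> E'; apply: RT; rewrite E'; apply: lin_l.
    apply: TS; rewrite -(point_eq N1 UT U1 ST (lin_r nPS)).
    exact: (point_eq N2 TT (lin_r nRT) UT U2).
- have OP : on O (lin O P) by apply: lin_l; auto.
  have OT : on O (lin O T) by apply: lin_l; auto.
  (* U completes the parallelogram on O, P, T with diagonal OT replaced by the side OU parallel to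
     PT, so OU is a third ray. *)
  have [U [U1 U2]] : exists U, on U (par T (lin O P)) /\ on U (par O (lin P T)).
    apply: lines_meet => H; apply: (not_parallel_off PP TP).
    apply: parallel_trans (parallel_sym (par_parallel O _)) _.
    exact: parallel_trans (parallel_sym H) (par_parallel T _).
  have OU : U <> O.
    move=> E; subst U; apply: TP; rewrite -(par_id OP); exact: on_par_sym.
  exists U; split=> //; split=> E.
  + apply: TP; rewrite -(par_id (P := U) (l := lin O P)); last exact: on_par_sym.
    by rewrite -E; apply: lin_r; auto.
  + have UT : on U (lin O T) by rewrite -E; apply: lin_r; auto.
    apply: (not_parallel_off TT PT).
    rewrite (line_eq OU UT OT U2 (on_par _ _)) -lin_sym //.
    exact/parallel_sym/par_parallel.
Qed.

(** The condition for a ray-preserving dilation to send A to A' and B to B'. Distinct rays make B'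
    determined by A, A' and B. *)
Definition perspective A A' B B' : Prop :=
  (regular p A /\ regular p A' /\ ray p A' = ray p A) /\
  (regular p B /\ regular p B' /\ ray p B' = ray p B) /\
  ray p A <> ray p B /\ parallel (lin A B) (lin A' B').

Lemma perspective_sym A A' B B' : perspective A A' B B' -> perspective B B' A A'.
Proof.
move=> [[gA [gA' EA]] [[gB [gB' EB]] [N H]]]; do ! split; auto.
rewrite (lin_sym (P := B)) 1?(lin_sym (P := B')) //; by apply: ray_neq; rewrite ?EA ?EB.
Qed.

Lemma perspective_id A B : regular p A -> regular p B -> ray p A <> ray p B ->
  perspective A A B B.
Proof. by do ! split => //; apply: parallel_refl. Qed.

(** The parallel lines AB and A'B share B, so A' is on AB; but AB meets the ray of A only in A. *)
Lemma perspective_inj A A' B : perspective A A' B B -> A = A'.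
Proof.
move=> [[gA [gA' EA]] [[gB _] [N H]]]; apply: NNPP => AA'.
have AB : A <> B by apply: ray_neq; auto.
have A'B : A' <> B by apply: ray_neq; rewrite EA; auto.
apply: (ray_off gA gB); first by auto.
rewrite (line_eq (l := ray p A) (m := lin A B) AA'); try exact: on_ray; try exact: lin_l.
- by rewrite -EA; apply: on_ray.
- by rewrite (playfair H (lin_r AB) (lin_r A'B)); apply: lin_l.
- exact: lin_r.
Qed.

Lemma perspective_fun A A' B B1 B2 :
  perspective A A' B B1 -> perspective A A' B B2 -> B1 = B2.
Proof.
move=> [[gA [gA' EA]] [[gB [gB1 EB1]] [N H1]]] [_ [[_ [gB2 EB2]] [_ H2]]].
have AB1 : A' <> B1 by apply: ray_neq; rewrite EA EB1; auto.
have AB2 : A' <> B2 by apply: ray_neq; rewrite EA EB2; auto.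
have E := playfair (parallel_trans (parallel_sym H1) H2) (lin_l AB1) (lin_l AB2).
apply: (point_eq (l := lin A' B1) (m := ray p B)).
- move=> E'; apply: (ray_off gB gA'); first by rewrite EA.
  by rewrite -E'; apply: lin_l.
- exact: lin_r.
- by rewrite -EB1; apply: on_ray.
- by rewrite E; apply: lin_r.
- by rewrite -EB2; apply: on_ray.
Qed.

Lemma perspective_ex A A' B : regular p A -> regular p A' -> ray p A' = ray p A ->
  regular p B -> ray p A <> ray p B -> exists B', perspective A A' B B'.
Proof.
move=> gA gA' EA gB N.
have AB : A <> B by apply: ray_neq; auto.
have BA : ~ on A (ray p B) by apply: ray_off.
have A'A : on A' (ray p A) by rewrite -EA; apply: on_ray.
have npar : ~ parallel (lin A B) (ray p B).
  by rewrite lin_sym //; apply: not_parallel_off => //; apply: on_ray.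
have [B' [B1 B2]] : exists B', on B' (par A' (lin A B)) /\ on B' (ray p B).
  apply: lines_meet => H; apply: npar.
  exact: parallel_trans (parallel_sym (par_parallel A' _)) H.
(* If B' were the centre O, the parallel to AB through A' would be OA, putting B on the ray of A. *)
have gB' : regular p B'.
  move: gA gA' EA N B1 B2 A'A BA npar; case: p gB => //= O BO AO A'O EA N B1 B2 A'A BA npar E.
  subst B'; apply: N.
  have E : par A' (lin A B) = lin O A.
    by apply: (line_eq A'O) => //; [apply: on_par|apply: lin_l; auto].
  have H : parallel (lin A B) (lin O A) by rewrite -E; apply/parallel_sym/par_parallel.
  have AOA : on A (lin O A) by apply: lin_r; auto.
  symmetry; apply: lin_eq; [by auto|by apply: lin_l; auto|].
  by rewrite -(playfair H (lin_l AB) AOA); apply: lin_r.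
have EB := ray_eq gB gB' B2.
have A'B' : A' <> B' by apply: ray_neq; rewrite EA EB; auto.
exists B'; do ! split => //.
by rewrite (lin_eq A'B' (on_par _ _) B1); apply/parallel_sym/par_parallel.
Qed.

Lemma perspective_trans A A' B B' C C' :
  perspective A A' B B' -> perspective B B' C C' -> ray p A <> ray p C ->
  perspective A A' C C'.
Proof.
move=> HAB HBC NAC.
have [[gA [gA' EA]] [[gB [gB' EB]] [NAB H1]]] := HAB.
have [_ [[gC [gC' EC]] [NBC H2]]] := HBC.
do ! split => //.
(* If one of the three points is fixed, so are the others; otherwise Desargues' axiom applies. *)
case: (classic (A = A')) => AA'.
  subst A'; have E := perspective_inj (perspective_sym HAB); subst B'.
  rewrite (perspective_inj (perspective_sym HBC)); exact: parallel_refl.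
have BB' : B <> B' by move=> E; subst B'; apply: AA'; apply: perspective_inj HAB.
have CC' : C <> C' by move=> E; subst C'; apply: BB'; apply: perspective_inj HBC.
apply: (desargues_lines (a := ray p A) (b := ray p B) (c := ray p C) (B := B) (B' := B')) => //;
  try (by apply: on_ray); try (by rewrite -?EA -?EB -?EC; apply: on_ray);
  try (by apply: ray_off => //; rewrite ?EA ?EB ?EC; auto).
case: rays_incidence => [H|[O H]]; first by left.
by right; exists O; auto.
Qed.

(* Here S and T lie on the same line of the pencil, so Desargues' axiom only
   applies through a third line of it. *)
Lemma perspective_switch P P' R R' S S' T T' :
  perspective P P' T T' -> perspective T T' R R' -> perspective P P' S S' ->
  ray p R = ray p P -> ray p S = ray p T -> perspective R R' S S'.
Proof.
move=> HPT HTR HPS ER ES.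
have [[gP [gP' EP]] [[gT [gT' ET]] [NPT H1]]] := HPT.
have [_ [[gR [gR' ER']] [NTR H2]]] := HTR.
have [_ [[gS [gS' ES']] [NPS H3]]] := HPS.
have NRS : ray p R <> ray p S by rewrite ER.
case: (classic (P = R)) => [E|PR].
  by subst R; rewrite -(perspective_fun (perspective_sym HPT) HTR).
case: (classic (T = S)) => [E|TS].
  by subst S; rewrite -(perspective_fun HPT HPS); apply: perspective_sym.
case: (classic (P = P')) => [E|PP'].
  subst P'; have E := perspective_inj (perspective_sym HPT); subst T'.
  rewrite -(perspective_inj (perspective_sym HTR)) -(perspective_inj (perspective_sym HPS)).
  exact: perspective_id.
have TT' : T <> T' by move=> E; subst T'; apply: PP'; apply: perspective_inj HPT.
have byU : (exists U, regular p U /\ ray p U <> ray p P /\ ray p U <> ray p T) ->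
    perspective R R' S S'.
  move=> [U [gU [UP UT]]].
  have [U' HU] : exists U', perspective P P' U U' by apply: perspective_ex; auto.
  have HUT : perspective U U' T T' by apply: perspective_trans (perspective_sym HU) HPT _.
  have HUS : perspective U U' S S'.
    by apply: perspective_trans (perspective_sym HU) HPS _; rewrite ES.
  have HUR : perspective U U' R R' by apply: perspective_trans HUT HTR _; rewrite ER.
  exact: perspective_trans (perspective_sym HUR) HUS _.
have nPS : P <> S by apply: ray_neq; auto.
have nRT : R <> T by apply: ray_neq; auto.
have nPT' : P <> T' by apply: ray_neq; rewrite ET; auto.
have nP'S : P' <> S by apply: ray_neq; rewrite EP; auto.
have NTP := not_eq_sym NPT.
(* Without a third ray, [third_ray] forces P' = R and T' = S. Then S' = T and R' = P, so the map
   swaps P with R and T with S, and the goal is [H1] reversed. *)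
have [/byU //|HPSRT] := third_ray gP gR gT gS ER ES NTP PR TS.
have [E|P'R] := classic (P' = R); last first.
{ have := third_ray gP' gR gT gS _ ES _ P'R TS.
  rewrite EP => /(_ ER NTP) [/byU //|H].
  exfalso; apply: (not_parallel_lin (P := P) (Q := P') (R := S) (l := ray p P)) => //.
  - exact: on_ray.
  - by rewrite -EP; apply: on_ray.
  - by apply: ray_off => //; auto.
  - exact: parallel_trans HPSRT (parallel_sym H). }
have [E'|T'S] := classic (T' = S); last first.
{ have [/byU //|H] := third_ray gP gR gT gT' ER ET NTP PR TT'.
  exfalso; apply: T'S.
  have E1 := playfair (parallel_trans H (parallel_sym HPSRT)) (lin_l nPT') (lin_l nPS).
  apply: (point_eq (l := ray p T) (m := lin P S)).
  - move=> E2; apply: (ray_off gT gP) => //; rewrite E2; exact: lin_l.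
  - by rewrite -ET; apply: on_ray.
  - by rewrite -E1; apply: lin_r.
  - by rewrite -ES; apply: on_ray.
  - exact: lin_r. }
subst P' T'.
have ES1 : S' = T by apply: perspective_fun HPS _; do ! split; auto.
have ER1 : R' = P.
  apply: perspective_fun HTR _; do ! split; auto.
  by rewrite (lin_sym (P := S)) 1?(lin_sym (P := T)); auto using parallel_sym.
subst S' R'; do ! split; auto.
exact: parallel_sym.
Qed.

(** The common source of translations (a pencil of parallels) and homotheties (a pencil with a
    centre). *)
Lemma pencil_map P P' : regular p P -> regular p P' -> ray p P' = ray p P ->
  exists f : point X -> point X, f P = P' /\
    (forall R, regular p R -> regular p (f R) /\ ray p (f R) = ray p R) /\
    (forall R S, regular p R -> regular p S -> ray p R <> ray p S ->
       perspective R (f R) S (f S)).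
Proof.
move=> gP gP' EP.
(* Points on the ray of P have no image in perspective with (P, P'), so they
   are mapped via an auxiliary T off that ray. *)
pose img R R' := perspective P P' R R' \/
  (ray p R = ray p P /\ exists T T', perspective P P' T T' /\ perspective T T' R R').
have ex_img R : regular p R -> exists R', img R R'.
  move=> gR; case: (classic (ray p R = ray p P)) => ER; last first.
    have [R' HR] : exists R', perspective P P' R R' by apply: perspective_ex; auto.
    by exists R'; left.
  have [T [gT NT]] := ray_other gP.
  have [T' HT] : exists T', perspective P P' T T' by apply: perspective_ex; auto.
  have [_ [[_ [gT' ET]] _]] := HT.
  have [R' HR] : exists R', perspective T T' R R' by apply: perspective_ex; rewrite ?ER; auto.
  by exists R'; right; split=> //; exists T, T'.
have img_regular R R' : img R R' -> regular p R' /\ ray p R' = ray p R.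
  by case=> [[_ [[_ [? ?]] _]]|[_ [T [T' [_ [_ [[_ [? ?]] _]]]]]]].
have img_off R R' : img R R' -> ray p R <> ray p P -> perspective P P' R R'.
  by case=> // -[].
have img_on R R' S S' : img R R' -> img S S' -> ray p R = ray p P -> ray p S <> ray p P ->
    perspective R R' S S'.
  move=> iR iS ER NS; have HS := img_off _ _ iS NS.
  case: iR => [[_ [_ [N _]]]|[_ [T [T' [HT HR]]]]]; first by case: N.
  (* R' was obtained through T. Either S is on the ray of T, or perspectivity passes from T through
     P to S and then to R. *)
  case: (classic (ray p S = ray p T)) => [EST|NST].
    exact: perspective_switch HT HR HS ER EST.
  apply: perspective_trans (perspective_sym HR) _ _; last by rewrite ER; auto.
  by apply: perspective_trans (perspective_sym HT) HS _; auto.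
have img_persp R R' S S' : img R R' -> img S S' -> ray p R <> ray p S ->
    perspective R R' S S'.
  move=> iR iS N.
  case: (classic (ray p R = ray p P)) => [ER|NR].
    by apply: img_on => //; rewrite -ER; auto.
  case: (classic (ray p S = ray p P)) => [ES|NS].
    by apply: perspective_sym; apply: img_on => //; rewrite -ES.
  exact: perspective_trans (perspective_sym (img_off _ _ iR NR)) (img_off _ _ iS NS) N.
have ex_f R : exists R', regular p R -> img R R'.
  case: (classic (regular p R)) => [/ex_img [R' H]|H]; first by exists R'.
  by exists R.
pose f R := proj1_sig (constructive_indefinite_description _ (ex_f R)).
have fP R : regular p R -> img R (f R).
  exact: (proj2_sig (constructive_indefinite_description _ (ex_f R))).
exists f; split; last by split=> [R gR|R S gR gS N]; auto.
(* P' and [f P] are both the image of P determined by a point S off its ray. *)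
have [S [gS NS]] := ray_other gP.
have HS := img_off _ _ (fP S gS) NS.
apply: (perspective_fun (A := S) (A' := f S)); last exact: perspective_sym HS.
by apply: img_persp; auto.
Qed.

Lemma perspective_on A A' B B' l : perspective A A' B B' -> on A l -> on B l ->
  on B' (par A' l).
Proof.
move=> [[_ [_ EA]] [[_ [_ EB]] [N H]]] Al Bl.
have AB : A <> B by apply: ray_neq; auto.
have A'B' : A' <> B' by apply: ray_neq; rewrite EA EB; auto.
rewrite -(lin_eq AB Al Bl) (par_eq (lin_l A'B') (parallel_sym H)); exact: lin_r.
Qed.

(** Perspectivity covers points on different rays; for distinct points on one ray, l is that ray,
    which f preserves. *)
Lemma perspective_map_on (f : point X -> point X) R S l :
  (forall R, regular p R -> regular p (f R) /\ ray p (f R) = ray p R) ->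
  (forall R S, regular p R -> regular p S -> ray p R <> ray p S ->
       perspective R (f R) S (f S)) ->
  regular p R -> regular p S -> on R l -> on S l -> on (f S) (par (f R) l).
Proof.
move=> Hreg Hpersp gR gS Rl Sl.
have [gR' ER'] := Hreg R gR; have [gS' ES'] := Hreg S gS.
case: (classic (ray p R = ray p S)) => [E|N]; last by apply: perspective_on Rl Sl; auto.
case: (classic (R = S)) => [->|RS]; first exact: on_par.
have -> : l = ray p R.
  by apply: (line_eq RS) => //; [apply: on_ray|rewrite E; apply: on_ray].
rewrite par_id; first by rewrite -ER'; apply: on_ray.
by rewrite E -ES'; apply: on_ray.
Qed.

End Pencils.

(** * Existence of translations and homotheties *)

Section Existence.
Context {X : desargues_plane}.
Implicit Types (P Q R S O I A : point X) (l m : line X) (f : point X -> point X).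

(** Quantifying over l avoids a case split: for O = A, every line through O qualifies, which forces
    the identity. *)
Definition translation O A f : Prop :=
  dilation f /\ f O = A /\
  forall l, on O l -> on A l -> forall R, on (f R) (par R l).

Definition homothety O I A f : Prop := dilation f /\ f O = O /\ f I = A.

Lemma ex_translation O A : exists f, translation O A f.
Proof.
case: (classic (O = A)) => [<-|OA].
  exists (fun P => P); split; [exact: dilation_id|by split=> // *; apply: on_par].
pose p := Parallels (lin O A).
have EA : ray p A = ray p O by rewrite /= !par_id //; [apply: lin_r|apply: lin_l].
have [f [fO [freg fpersp]]] := pencil_map (p := p) Logic.I Logic.I EA.
exists f; split; [|split=> // l Ol Al R].
  by move=> P Q l; apply: (perspective_map_on freg fpersp).
rewrite -(lin_eq OA Ol Al).
have [_ /= <-] := freg R Logic.I; exact: on_par.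
Qed.

Lemma ex_homothety O I A l : O <> I -> on O l -> on I l -> on A l ->
  exists f, homothety O I A f.
Proof.
move=> OI Ol Il Al.
case: (classic (A = O)) => [->|AO].
  by exists (fun _ => O); split; [exact: dilation_const|].
have EA : ray (Center O) A = ray (Center O) I.
  by rewrite /= !(@lin_eq _ O _ l); auto.
have [f [fI [freg fpersp]]] := pencil_map (p := Center O) (not_eq_sym OI) AO EA.
(* The centre is not regular, so the value of f there is arbitrary and is reset to O. *)
pose g R := match excluded_middle_informative (R = O) with left _ => O | right _ => f R end.
have gO : g O = O by rewrite /g; case: excluded_middle_informative.
have gf R : R <> O -> g R = f R by rewrite /g; case: excluded_middle_informative.
have fray R m : R <> O -> on O m -> on R m -> on (f R) m.
  move=> RO Om Rm; have [/= fRO E] := freg R RO.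
  by rewrite -(lin_eq (not_eq_sym RO) Om Rm) -E; apply: lin_r; auto.
exists g; split; [|by split=> //; rewrite gf; auto].
move=> P Q m Pm Qm.
case: (classic (Q = O)) => [EQ|QO].
  subst Q; rewrite gO; apply: on_par_sym; rewrite par_id //.
  by case: (classic (P = O)) => [->|PO]; rewrite ?gO // gf //; apply: fray.
case: (classic (P = O)) => [EP|PO].
  by subst P; rewrite gO par_id // gf //; apply: fray.
by rewrite !gf //; apply: (perspective_map_on freg fpersp).
Qed.

End Existence.

(** * Translations and vector addition with origin O *)

Section Translations.
Context {X : desargues_plane}.
Implicit Types (P Q R S O A B C : point X) (l m : line X) (f g : point X -> point X).

(** A fixed point R off OA would put A on OR. A fixed point on OA would fix each R off OA, as the
    intersection of PR with the parallel to OA through R. *)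
Lemma translation_fix O A f P : translation O A f -> f P = P -> A = O.
Proof.
move=> [df [fO trf]] fP; apply: NNPP => AO.
have OA := not_eq_sym AO; have [Ol Al] := lin_spec OA.
have nofix R : ~ on R (lin O A) -> f R <> R.
  move=> Rl fR; apply: Rl; have OR : O <> R by move=> E; subst R; case: AO; rewrite -fO.
  have H := df _ _ _ (lin_r OR) (lin_l OR).
  rewrite fO fR par_id in H; first exact: lin_r.
  by rewrite (line_eq OA Ol Al (lin_l OR) H); apply: lin_r.
case: (classic (on P (lin O A))) => [Pl|/nofix //].
have [R Rl] := off_line (lin O A).
apply: (nofix R Rl).
have PR : P <> R by move=> E; subst.
apply: (point_eq (l := lin P R) (m := par R (lin O A))).
- move=> E; apply: (not_parallel_off Pl Rl); rewrite E; exact: par_parallel.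
- have := df _ _ _ (lin_l PR) (lin_r PR).
  by rewrite fP par_id //; apply: lin_l.
- exact: trf.
- exact: lin_r.
- exact: on_par.
Qed.

Lemma translation_uniq O A f g : translation O A f -> translation O A g ->
  forall R, f R = g R.
Proof.
move=> [df [fO trf]] [dg [gO trg]].
have [l [Ol Al]] := line_through O A.
have [R Rl] := off_line l.
have OR : O <> R by move=> E; subst.
apply: (dilation_ext df dg OR); first by rewrite fO.
apply: (point_eq (par_neq (P := A) (Q := R) (not_parallel_off Ol Rl))).
- by rewrite -fO; apply: df; [apply: lin_l|apply: lin_r].
- exact: trf.
- by rewrite -gO; apply: dg; [apply: lin_l|apply: lin_r].
- exact: trg.
Qed.

Definition transl O A : point X -> point X :=
  proj1_sig (constructive_indefinite_description _ (ex_translation O A)).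

Lemma translP O A : translation O A (transl O A).
Proof. exact: proj2_sig (constructive_indefinite_description _ (ex_translation O A)). Qed.

Variable O : point X.
Local Notation "A ⊕ B" := (transl O A B) (at level 50, left associativity).

Lemma transl_dilation A : dilation (transl O A).
Proof. by case: (translP O A). Qed.

Lemma addv0 A : A ⊕ O = A.
Proof. by case: (translP O A) => _ []. Qed.

(** Together with [transl_side], this makes O, A, A ⊕ B, B a parallelogram. *)
Lemma transl_trace A B l : on O l -> on A l -> on (A ⊕ B) (par B l).
Proof. by move=> Ol Al; case: (translP O A) => _ [_]; apply. Qed.

Lemma transl_side A B l : on O l -> on B l -> on (A ⊕ B) (par A l).
Proof. by move=> Ol Bl; rewrite -{2}(addv0 A); apply: transl_dilation. Qed.

Lemma transl_on A B l : on O l -> on A l -> on B l -> on (A ⊕ B) l.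
Proof. by move=> Ol Al Bl; rewrite -(par_id Bl); apply: transl_trace. Qed.

Lemma addvC_off A B l : on O l -> on A l -> ~ on B l -> A ⊕ B = B ⊕ A.
Proof.
move=> Ol Al Bl; have OB : O <> B by move=> E; subst.
have [OB1 OB2] := lin_spec OB.
apply: (point_eq (par_neq (P := A) (Q := B) (not_parallel_off Ol Bl))).
- exact: transl_side.
- exact: transl_trace.
- exact: transl_trace.
- exact: transl_side.
Qed.

(* The composite of translations in different directions has no fixed point,
   which makes it a translation. *)
Lemma transl_comp A B l : on O l -> on A l -> ~ on B l -> forall C,
  A ⊕ (B ⊕ C) = (A ⊕ B) ⊕ C.
Proof.
move=> Ol Al Bl C; case: (classic (A = O)) => [->|AO].
  have id P : O ⊕ P = P.
    apply: (translation_uniq (translP O O) (g := fun P => P)).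
    by split; [exact: dilation_id|split=> // *; apply: on_par].
  by rewrite !id.
have OB : O <> B by move=> E; subst.
have [OB1 OB2] := lin_spec OB.
have dAB := dilation_comp (transl_dilation A) (transl_dilation B).
apply: (translation_uniq (O := O) (A := A ⊕ B) (f := fun P => A ⊕ (B ⊕ P))); last exact: translP.
split=> //; split; first by rewrite addv0.
move=> m Om ABm; apply: (trace_parallel (P := O)) => //; last by rewrite addv0.
move=> P EP.
(* B ⊕ P lies on the parallels through P to l and to OB. *)
have BP : B ⊕ P = P.
{ apply: (point_eq (par_neq (P := P) (Q := P) (not_parallel_off Ol Bl))).
  - exact: transl_trace.
  - by apply: on_par_sym; rewrite -{1}EP; apply: transl_trace.
  - exact: on_par.
  - exact: on_par. }
by apply: OB; symmetry; apply: translation_fix (translP O B) BP.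
Qed.

(* For A, B on one line through O, compare both composites of the translations
   at points off that line, where they agree by [addvC_off]. *)
Lemma addvC A B : A ⊕ B = B ⊕ A.
Proof.
have [l [Ol Al]] := line_through O A.
have [m [Om Bm]] := line_through O B.
case: (classic (on B l)) => [Bl|]; last exact: addvC_off.
case: (classic (on A m)) => [Am|Am]; last by symmetry; apply: addvC_off Am.
case: (classic (A = B)) => [->//|AB].
have off C : ~ on C l -> A ⊕ (B ⊕ C) = B ⊕ (A ⊕ C).
  move=> Cl.
  have BCl : ~ on (B ⊕ C) l.
    move=> H; apply: Cl; rewrite -(par_id H); apply: on_par_sym; exact: transl_trace.
  rewrite (addvC_off Ol Al BCl) -(transl_comp Ol Bl Cl).
  by rewrite (addvC_off Ol Al Cl).
have [C Cl] := off_line l.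
have dA := transl_dilation A; have dB := transl_dilation B.
(* A second point off l comes from translating C by whichever of A, B is not O; agreement at C and D
   then carries over to O. *)
have [D [Dl CD]] : exists D, ~ on D l /\ C <> D.
  case: (classic (A = O)) => [EA|AO].
    exists (B ⊕ C); split.
      move=> H; apply: Cl; rewrite -(par_id H); apply: on_par_sym; exact: transl_trace.
    by move=> E; apply: AB; rewrite EA; symmetry; apply: translation_fix (translP O B) (esym E).
  exists (A ⊕ C); split.
    move=> H; apply: Cl; rewrite -(par_id H); apply: on_par_sym; exact: transl_trace.
  by move=> E; apply: AO; apply: translation_fix (translP O A) (esym E).
have := dilation_ext (dilation_comp dA dB) (dilation_comp dB dA) CD (off C Cl) (off D Dl) O.
by rewrite !addv0.
Qed.

(** Otherwise the translation would be constant with value A, yet it keeps each R off l on the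
    parallel to l through R. *)
Lemma addv_inj A P Q : A ⊕ P = A ⊕ Q -> P = Q.
Proof.
move=> E; apply: NNPP => PQ.
have [l [Ol Al]] := line_through O A.
have [R Rl] := off_line l; apply: Rl.
have H := dilation_ext (transl_dilation A) (dilation_const (A ⊕ P)) PQ erefl (esym E).
have := transl_trace R Ol Al; rewrite (H R) -(H O) addv0 => /on_par_sym.
by rewrite par_id.
Qed.

(** As functions of B, both sides are dilations. They agree at O, and at a point R off OA because f
    maps parallelograms to parallelograms. *)
Lemma dilation_addv f A B : dilation f -> f O = O -> f (A ⊕ B) = f A ⊕ f B.
Proof.
move=> df fO.
have [l [Ol Al]] := line_through O A.
have [R Rl] := off_line l.
have OR : O <> R by move=> E; subst.
have [OR1 OR2] := lin_spec OR.
have fl P m : on O m -> on P m -> on (f P) m.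
  by move=> Om Pm; rewrite -(par_id Om) -fO; apply: df.
apply: (dilation_ext (f := fun B => f (A ⊕ B)) (g := fun B => f A ⊕ f B) _ _ OR).
- exact: dilation_comp (transl_dilation A).
- exact: dilation_comp (transl_dilation (f A)) df.
- by rewrite fO !addv0.
- apply: (point_eq (par_neq (P := f A) (Q := f R) (not_parallel_off Ol Rl))).
  + rewrite -(par_par _ A); apply: df; [exact: on_par|exact: transl_side].
  + rewrite -(par_par _ R); apply: df; [exact: on_par|exact: transl_trace].
  + by apply: transl_side => //; apply: fl.
  + by apply: transl_trace => //; apply: fl.
Qed.

(** One summand moves at a time: translation by [f P] handles the change of g, and, after commuting,
    translation by [g Q] that of f. *)
Lemma dilation_sum f g : dilation f -> dilation g -> dilation (fun P => f P ⊕ g P).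
Proof.
move=> df dg P Q l Pl Ql.
have H1 : on (f P ⊕ g Q) (par (f P ⊕ g P) l).
  rewrite -(par_par _ (g P)); apply: transl_dilation; [exact: on_par|exact: dg].
have H2 : on (f Q ⊕ g Q) (par (f P ⊕ g Q) l).
  rewrite !(addvC _ (g Q)) -(par_par _ (f P)).
  apply: transl_dilation; [exact: on_par|exact: df].
by rewrite -(par_on H1).
Qed.

End Translations.

(** * Arithmetic of the line OI through translations and homotheties *)

Section LineArithmetic.
Context {X : desargues_plane}.
Variables O I : point X.
Hypothesis OI : O <> I.
Implicit Types A B C : point X.
Local Notation L := (lin O I).

Definition homot A : point X -> point X :=
  epsilon (inhabits (fun P => P)) (homothety O I A).

Lemma homotP A : on A L -> homothety O I A (homot A).
Proof.
move=> AL; apply: (epsilon_spec _ (homothety O I A)).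
exact: (ex_homothety OI (lin_l OI) (lin_r OI) AL).
Qed.

Lemma homot_uniq A f P : on A L -> homothety O I A f -> homot A P = f P.
Proof.
move=> AL [df [fO fI]]; have [dh [hO hI]] := homotP AL.
by apply: (dilation_ext dh df OI); [rewrite hO|rewrite hI].
Qed.

Lemma homot_on A P l : on A L -> on O l -> on P l -> on (homot A P) l.
Proof.
move=> AL Ol Pl; have [dh [hO hI]] := homotP AL.
by rewrite -(par_id Ol) -hO; apply: dh.
Qed.

(** The point P1 is the translate of B1, so the parallel to B1 B through P1 contains the translate
    of B. The same argument with homotheties gives [mul_auxE]. *)
Lemma add_auxE A B B1 : on A L -> on B L -> ~ on B1 L -> add_aux O I B1 A B = transl O A B.
Proof.
move=> AL BL B1L; have [OL IL] := lin_spec OI.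
have nO : O <> B1 by move=> E; subst.
have nB : B1 <> B by move=> E; subst.
have P1 : meet (par B1 L) (par A (lin O B1)) = transl O A B1.
{ apply: meet_eq.
  - by apply: not_eq_sym; apply: par_neq; apply: not_parallel_off.
  - exact: transl_trace.
  - by apply: transl_side; [apply: lin_l|apply: lin_r]. }
rewrite /add_aux P1.
apply: meet_eq; last exact: transl_on.
- by rewrite -(par_id OL); apply: par_neq; apply: not_parallel_off.
- apply: transl_dilation; [apply: lin_r|apply: lin_l]; auto.
Qed.

Lemma mul_auxE A B B1 : on A L -> on B L -> ~ on B1 L -> mul_aux O I B1 A B = homot A B.
Proof.
move=> AL BL B1L; have [OL IL] := lin_spec OI.
have [dh [hO hI]] := homotP AL.
have nO : O <> B1 by move=> E; subst.
have nI : I <> B1 by move=> E; subst.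
have nB : B1 <> B by move=> E; subst.
have P1 : meet (par A (lin I B1)) (lin O B1) = homot A B1.
{ apply: meet_eq.
  - rewrite -(par_id (lin_l nO)); apply: par_neq.
    by apply: (not_parallel_lin IL OL) => //; auto.
  - by rewrite -{2}hI; apply: dh; [apply: lin_l|apply: lin_r].
  - by apply: homot_on => //; [apply: lin_l|apply: lin_r]. }
rewrite /mul_aux P1.
apply: meet_eq; last exact: homot_on.
- by rewrite -(par_id OL); apply: par_neq; apply: not_parallel_off.
- apply: dh; [apply: lin_r|apply: lin_l]; auto.
Qed.

Lemma addE A B : on A L -> on B L -> add O I A B = transl O A B.
Proof.
move=> AL BL; have [B1 HB1] := off_line L.
have [|B2 [HB2 E]] := epsilon_spec (point_inhabited X)
  (fun S => exists B1, ~ on B1 L /\ S = add_aux O I B1 A B).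
  by exists (add_aux O I B1 A B), B1.
by rewrite /add E add_auxE.
Qed.

Lemma mulE A B : on A L -> on B L -> mul O I A B = homot A B.
Proof.
move=> AL BL; have [B1 HB1] := off_line L.
have [|B2 [HB2 E]] := epsilon_spec (point_inhabited X)
  (fun S => exists B1, ~ on B1 L /\ S = mul_aux O I B1 A B).
  by exists (mul_aux O I B1 A B), B1.
by rewrite /mul E mul_auxE.
Qed.

Lemma add_on A B : on A L -> on B L -> on (add O I A B) L.
Proof. by move=> AL BL; rewrite addE //; apply: transl_on => //; apply: lin_l. Qed.

Lemma mul_on A B : on A L -> on B L -> on (mul O I A B) L.
Proof. by move=> AL BL; rewrite mulE //; apply: homot_on => //; apply: lin_l. Qed.

(** If [f A] differs from [f O], the two span OI, so OA is parallel to OI and shares O with it;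
    otherwise A = O by injectivity. *)
Lemma on_of_image f A B : dilation f -> on (f O) L -> f O <> f I -> on (f I) L ->
  on B L -> f A = B -> on A L.
Proof.
move=> df fO fOI fI BL E.
have [OL IL] := lin_spec OI.
case: (classic (f A = f O)) => [EA|NA].
  by rewrite (dilation_inj df fOI EA).
have OA : O <> A by move=> E'; apply: NA; rewrite -E'.
have AL : on (f A) L by rewrite E.
have H : par (f O) (lin O A) = L.
  apply: (line_eq NA (df _ _ _ (lin_l OA) (lin_r OA)) (on_par _ _) AL fO).
have HL : parallel (lin O A) L by rewrite -H; apply/parallel_sym/par_parallel.
by rewrite -(playfair HL (lin_l OA) OL); apply: lin_r.
Qed.

(** The choice [opp] is meaningful because translations are surjective; [inv_on] uses the
    surjectivity of nonzero homotheties. *)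
Lemma opp_on A : on A L -> on (opp O I A) L.
Proof.
move=> AL; have [OL IL] := lin_spec OI.
suff [S [SL SE]] : exists S, on S L /\ add O I A S = O.
  have [] // := epsilon_spec (point_inhabited X) (fun S => on S L /\ add O I A S = O).
  by exists S.
have dA := transl_dilation O A.
have NOI : transl O A O <> transl O A I.
  by move=> /addv_inj.
have [S ES] := dilation_surj O dA NOI.
have SL : on S L by apply: (on_of_image dA _ NOI _ OL ES); apply: transl_on.
by exists S; split; rewrite ?addE.
Qed.

Lemma inv_on A : on A L -> on (inv O I A) L.
Proof.
move=> AL; have [OL IL] := lin_spec OI.
suff [S HS] : exists S, on S L /\ (A <> O -> mul O I A S = I /\ mul O I S A = I).
  have [] // := epsilon_spec (point_inhabited X)
    (fun S => on S L /\ (A <> O -> mul O I A S = I /\ mul O I S A = I)).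
  by exists S.
case: (classic (A = O)) => [->|AO]; first by exists O.
have [dA [A0 A1]] := homotP AL.
have NOI : homot A O <> homot A I by rewrite A0 A1; auto.
have [S ES] := dilation_surj I dA NOI.
have SL : on S L by apply: (on_of_image dA _ NOI _ IL ES); apply: homot_on.
exists S; split=> // _; rewrite !mulE //; split=> //.
have [dS [S0 S1]] := homotP SL.
(* Since A · S = I, the composite of the homotheties of S and then A fixes O and I, so it is the
   identity; cancelling A gives S · A = I. *)
apply: (dilation_inj dA NOI).
rewrite A1; apply: (dilation_ext (dilation_comp dA dS) (dilation_id (X := X)) OI).
- by rewrite S0.
- by rewrite S1.
Qed.

(** Positions where an inverse of O occurs are included, since [inv_on] also holds at O. *)
Lemma cross_ratio_on A B C D : on A L -> on B L -> on C L -> on D L ->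
  on (cross_ratio O I A B C D) L.
Proof.
move=> AL BL CL DL.
have sub_on P Q : on P L -> on Q L -> on (sub O I P Q) L.
  by move=> PL QL; apply: add_on => //; apply: opp_on.
by rewrite /cross_ratio; repeat (apply: mul_on || apply: inv_on || apply: sub_on).
Qed.

Lemma mulDr A B C : on A L -> on B L -> on C L ->
  mul O I A (add O I B C) = add O I (mul O I A B) (mul O I A C).
Proof.
move=> AL BL CL; have [dA [A0 A1]] := homotP AL.
rewrite (mulE AL (add_on BL CL)) (addE (mul_on AL BL) (mul_on AL CL)) addE // !mulE //.
exact: dilation_addv.
Qed.

Lemma mulDl A B C : on A L -> on B L -> on C L ->
  mul O I (add O I A B) C = add O I (mul O I A C) (mul O I B C).
Proof.
move=> AL BL CL; have ABL := add_on AL BL.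
rewrite (addE (mul_on AL CL) (mul_on BL CL)) !mulE //.
have [dA [A0 A1]] := homotP AL; have [dB [B0 B1]] := homotP BL.
apply: (homot_uniq _ (f := fun P => transl O (homot A P) (homot B P)) ABL).
split; first exact: dilation_sum; split; first by rewrite A0 B0 addv0.
by rewrite A1 B1 addE.
Qed.

End LineArithmetic.

Theorem theorem6 (X : desargues_plane) (O I : point X) (hOI : O <> I)
    (A C D : point X)
    (hA : on A (lin O I)) (hC : on C (lin O I)) (hD : on D (lin O I))
    (fX fY fZ : point X)
    (hX : R4B O I A C D fX) (hY : R4B O I A C D fY) (hZ : R4B O I A C D fZ) :
  mul O I fX (add O I fY fZ) = add O I (mul O I fX fY) (mul O I fX fZ) /\
  mul O I (add O I fX fY) fZ = add O I (mul O I fX fZ) (mul O I fY fZ).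
Proof.
have R4B_on r : R4B O I A C D r -> on r (lin O I).
  by move=> [B [BL ->]]; apply: cross_ratio_on.
by split; [apply: mulDr|apply: mulDl]; auto.
Qed.
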